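(* Let $N\ge 1$ and let $f,g,h,s,\mu,\theta,\nu$ be the following Casoratians built from the column vector $\boldsymbol\psi(l)$ defined in the context: $$f=|0,1,\dots,N-1|,\quad g=|0,\dots,N-2,N|,\quad h=|0,\dots,N-2,N+1|,\quad s=|0,\dots,N-3,N-1,N|,$$ $$\mu=|0,\dots,N-2,N+2|,\quad \theta=|0,\dots,N-3,N-1,N+1|,\quad \nu=|0,\dots,N-4,N-2,N-1,N|.$$ Then, as functions of $(n,m)\in\mathbb Z^2$ (with $\alpha,\beta$ fixed), they satisfy the bilinear system (GD-4 (B-2) bilinear form) $$\widetilde f(pg+h)-\widetilde g(pf+g)+f\widetilde s=0,\qquad \widehat f(qg+h)-\widehat g(qf+g)+f\widehat s=0,$$ $$\widetilde f(ph+\mu)-\widetilde h(pf+g)+f\widetilde\theta=0,\qquad \widehat f(qh+\mu)-\widehat h(qf+g)+f\widehat\theta=0,$$ $$\widetilde f(ps+\theta)-f(p\widetilde s-\widetilde\nu)-\widetilde g s=0,\qquad \widehat f(qs+\theta)-f(q\widehat s-\widehat\nu)-\widehat g s=0,$$ $$(p-q)(\widetilde f\widehat f-f\widehat{\widetilde f})+\widetilde f\widehat g-\widehat f\widetilde g=0,$$ $$\frac{G(-p,-q)}{p-q}(f\widehat{\widetilde f}-\widetilde f\widehat f)+H(p,q)(g\widehat{\widetilde f}-f\widehat{\widetilde g})-(p+q-\alpha_3)(g\widehat{\widetilde g}-f\widehat{\widetilde h}-\widehat{\widetilde f}s)+g\widehat{\widetilde h}-s\widehat{\widetilde g}-f\widehat{\widetilde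 \mu}+\nu\widehat{\widetilde f}=0.$$
   Context: Fix $\alpha_1,\alpha_2,\alpha_3\in\mathbb C$ and put $G(\omega,k)=\omega^4-k^4+\alpha_3(\omega^3-k^3)+\alpha_2(\omega^2-k^2)+\alpha_1(\omega-k)$ and $H(p,q)=p^2+pq+q^2-\alpha_3(p+q)+\alpha_2$. Let $p,q,a,b\in\mathbb C$ be pairwise distinct parameters. Fix $N\ge1$ and $k_1,\dots,k_N\in\mathbb C$; for each $s$ let $\omega_1(k_s),\dots,\omega_4(k_s)$ be the four roots in $\omega$ of $G(-\omega,-k_s)=0$, i.e. of $\omega^4-\alpha_3\omega^3+\alpha_2\omega^2-\alpha_1\omega=k_s^4-\alpha_3k_s^3+\alpha_2k_s^2-\alpha_1k_s$, with $\omega_4(k_s)=k_s$. For arbitrary constants $\rho^{(0)}_{j,s}\in\mathbb C$ define, for $(n,m,\alpha,\beta,l)\in\mathbb Z^5$, $\psi_s(n,m,\alpha,\beta,l)=\sum_{j=1}^4\rho^{(0)}_{j,s}(-\omega_j(k_s))^l(p-\omega_j(k_s))^n(q-\omega_j(k_s))^m(a-\omega_j(k_s))^\alpha(b-\omega_j(k_s))^\beta$, and $\boldsymbol\psi(l)=(\psi_1,\dots,\psi_N)^T$ (dependence on $n,m,\alpha,\beta$ suppressed). Casoratian notation: $|l_1,\dots,l_N|=\det(\boldsymbol\psi(l_1),\dots,\boldsymbol\psi(l_N))$; a run ''$0,\dots,j$'' with $j<0$ is empty, and if the listed indices number more than $N$ (possible only for small $N$) the symbol is defined to be $0$. Shift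 notation for a function $F(n,m)$: $\widetilde F=F(n+1,m)$, $\widehat F=F(n,m+1)$, $\widehat{\widetilde F}=F(n+1,m+1)$. *)

(* Defs.v *)
From HB Require Import structures.
From mathcomp Require Import all_boot all_order all_algebra.
Set Implicit Arguments. Unset Strict Implicit. Unset Printing Implicit Defensive.
Import Order.TTheory GRing.Theory Num.Theory.
Local Open Scope ring_scope.

Definition Gfun (C : numClosedFieldType) (a1 a2 a3 w k : C) : C :=
  w ^+ 4 - k ^+ 4 + a3 * (w ^+ 3 - k ^+ 3) + a2 * (w ^+ 2 - k ^+ 2) + a1 * (w - k).

Definition Hfun (C : numClosedFieldType) (a2 a3 p q : C) : C :=
  p ^+ 2 + p * q + q ^+ 2 - a3 * (p + q) + a2.

(* psi_s(n,m,alpha,beta,l); only l >= 0 is ever used in the Casoratians *)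
Definition psi (C : numClosedFieldType) (N : nat) (om rho : 'I_N -> 'I_4 -> C)
  (p q a b : C) (s : 'I_N) (n m al be : int) (l : nat) : C :=
  \sum_(j < 4) rho s j * (- om s j) ^+ l * (p - om s j) ^ n * (q - om s j) ^ m
               * (a - om s j) ^ al * (b - om s j) ^ be.

Definition casor (C : numClosedFieldType) (N : nat) (om rho : 'I_N -> 'I_4 -> C)
  (p q a b : C) (L : seq nat) (n m al be : int) : C :=
  if size L == N then
    \det (\matrix_(i < N, j < N) psi om rho p q a b i n m al be (nth 0%N L j))
  else 0.

(* index lists; "0,...,j" with j<0 is empty (truncated subtraction) *)
Definition f_idx (N : nat) : seq nat := iota 0 N.
Definition g_idx (N : nat) : seq nat := iota 0 (N - 1) ++ [:: N].
Definition h_idx (N : nat) : seq nat := iota 0 (N - 1) ++ [:: N.+1].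
Definition s_idx (N : nat) : seq nat := iota 0 (N - 2) ++ [:: (N - 1)%N; N].
Definition mu_idx (N : nat) : seq nat := iota 0 (N - 1) ++ [:: N.+2].
Definition theta_idx (N : nat) : seq nat := iota 0 (N - 2) ++ [:: (N - 1)%N; N.+1].
Definition nu_idx (N : nat) : seq nat := iota 0 (N - 3) ++ [:: (N - 2)%N; (N - 1)%N; N].

(* Main.v *)
Require Import Defs.
From HB Require Import structures.
From mathcomp Require Import all_boot all_order all_algebra.
From mathcomp Require Import ring zify.
Import Order.TTheory GRing.Theory Num.Theory.
Local Open Scope ring_scope.

(** Each entry [psi_s] at fixed [(n, m)] is a linear functional on polynomials,
[P |-> sum_j w_{s,j} P(- omega_j(k_s))], evaluated at [P = X^l]; the shift
[n -> n+1] precomposes it with multiplication by [X + p]. Let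
[T P = |0, ..., N-2, P|] and let
[K(X) = f X^N - g X^(N-1) + s X^(N-2) - nu X^(N-3) + ...], which all [psi_s]
annihilate by Cramer's rule; then [K(-p) = (-1)^N] times the shifted [f].
Every bilinear identity says that a determinant with the last column annihilated
by all [psi_s] vanishes: this column is [(X + p)] times the shifted [K] (or its
analogue with top term [f X^(N+1)]) in the first seven identities. In the last one it is [L K], where
[L = X^4 + a3 X^3 + a2 X^2 + a1 X] takes the same value at the four nodes of each
[psi_s], so that [L K] is annihilated too, and one divides [L] by
[(X + p) (X + q)]. *)

(** * Polynomial functionals, their shifts, and determinants in their values *)

Definition twist {R : comNzRingType} {n : nat}
  (v : {linear {poly R} -> 'cV[R]_n}) (Q P : {poly R}) : 'cV[R]_n := v (Q * P).

Lemma twist_is_linear (R : comNzRingType) (n : nat)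
  (v : {linear {poly R} -> 'cV[R]_n}) (Q : {poly R}) : linear (twist v Q).
Proof. by move=> a P1 P2; rewrite /twist mulrDr -scalerAr linearP. Qed.
HB.instance Definition _ (R : comNzRingType) (n : nat)
  (v : {linear {poly R} -> 'cV[R]_n}) (Q : {poly R}) :=
  GRing.isLinear.Build R {poly R} 'cV[R]_n _ (twist v Q) (twist_is_linear R n v Q).

(* Adds evaluation at [x] as an extra functional; expanding the resulting determinant
   along that row evaluates [kerp] at [x]. *)
Definition bordered {R : comNzRingType} {n : nat}
  (v : {linear {poly R} -> 'cV[R]_n}) (x : R) (P : {poly R}) : 'cV[R]_(1 + n) :=
  col_mx (P.[x])%:M (v P).

Lemma bordered_is_linear (R : comNzRingType) (n : nat)
  (v : {linear {poly R} -> 'cV[R]_n}) (x : R) : linear (bordered v x).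
Proof.
move=> a P1 P2; rewrite /bordered linearP !hornerE scale_col_mx add_col_mx.
by rewrite raddfD /= scale_scalar_mx.
Qed.
HB.instance Definition _ (R : comNzRingType) (n : nat)
  (v : {linear {poly R} -> 'cV[R]_n}) (x : R) :=
  GRing.isLinear.Build R {poly R} 'cV[R]_(1 + n) _ (bordered v x)
    (bordered_is_linear R n v x).

(** The last column is a separate argument because the proof works by linearity in [P] with the
    other [M] columns fixed. *)
Definition bdet {R : comNzRingType} {M : nat}
  (v : {poly R} -> 'cV[R]_M.+1) (E : nat -> {poly R}) (P : {poly R}) : R :=
  \det (\matrix_(i < M.+1, j < M.+1) v (if (j < M)%N then E j else P) i ord0).

(* With [N = M.+1]: f, g, h, mu are the hooks (0, 0), (0, 1), (0, 2), (0, 3), then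
   s = (1, 1), theta = (1, 2) and nu = (2, 1). *)
Definition hook {R : comNzRingType} {M : nat}
  (v : {poly R} -> 'cV[R]_M.+1) (d e : nat) : R :=
  if (d <= M)%N then bdet v (fun j => 'X^(bump (M - d) j)) 'X^(M + e) else 0.

(** The lower coefficients are Cramer's numerators for writing [v 'X^(M + e)] in terms of the
    [v 'X^k] with [k <= M]. Multiplying by [hook v 0 0] instead of dividing keeps the formula valid
    when that determinant is 0. The case [e = 1] is [K]; [e = 2] is its analogue one degree
    higher. *)
Definition kerp {R : comNzRingType} {M : nat}
  (v : {poly R} -> 'cV[R]_M.+1) (e : nat) : {poly R} :=
  hook v 0 0 *: 'X^(M + e)
  - \poly_(k < M.+1) ((-1) ^+ (M - k) * hook v (M - k) e).

(** * Cramer's rule and determinants as linear forms in the last column *)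

Section BorderedDet.
Context {R : comNzRingType} {M : nat}.
Implicit Types (v : {linear {poly R} -> 'cV[R]_M.+1}) (E : nat -> {poly R}).
Implicit Types (P Q : {poly R}).

Lemma eq_bdet (v w : {poly R} -> 'cV[R]_M.+1) E E' P P' :
  v P = w P' -> (forall j, (j < M)%N -> v (E j) = w (E' j)) ->
  bdet v E P = bdet w E' P'.
Proof.
move=> eqP eqE; congr (\det _); apply/matrixP=> i j; rewrite !mxE.
by case: ifP => [/eqE ->|]; rewrite ?eqP.
Qed.

(** The cofactors come from a matrix with last column 0, so they visibly do not depend on [P];
    linearity follows. *)
Lemma bdetE v E P :
  bdet v E P = \sum_(i < M.+1) v P i ord0 *
    cofactor (\matrix_(i < M.+1, j < M.+1) v (if (j < M)%N then E j else 0) i ord0)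
      i ord_max.
Proof.
rewrite /bdet (expand_det_col _ ord_max); apply: eq_bigr => i _.
rewrite mxE ltnn; congr (_ * _).
rewrite /cofactor; congr (_ * \det _); apply/matrixP=> k j; rewrite !mxE.
by rewrite lift_max ltn_ord.
Qed.

Lemma bdet_is_linear v E : linear_for *%R (bdet v E).
Proof.
move=> a P1 P2; rewrite !bdetE mulr_sumr -big_split; apply: eq_bigr => i _ /=.
by rewrite linearP; set c := cofactor _ _ _; rewrite !mxE; ring.
Qed.
HB.instance Definition _ v E :=
  GRing.isLinear.Build R {poly R} R _ (bdet v E) (bdet_is_linear v E).

Lemma bdet_ker v E P : v P = 0 -> bdet v E P = 0.
Proof. by move=> vP; rewrite bdetE vP big1 // => i _; rewrite mxE mul0r. Qed.

Lemma bdet_repeat v E k : (k < M)%N -> bdet v E (E k) = 0.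
Proof.
move=> ltk; have ltk' : (k < M.+1)%N by exact: ltnW.
rewrite /bdet -det_tr; apply: (determinant_alternate (i1 := Ordinal ltk') (i2 := ord_max)).
  by rewrite -val_eqE /= neq_ltn ltk.
by move=> i; rewrite !mxE /= ltk ltnn.
Qed.

Definition vdm v : 'M[R]_M.+1 := \matrix_(i < M.+1, j < M.+1) v 'X^j i ord0.

Lemma det_vdm v : \det (vdm v) = hook v 0 0.
Proof.
rewrite /hook /= subn0 addn0; congr (\det _); apply/matrixP=> i j; rewrite !mxE.
case: ifP => [ltj|/negbT]; first by rewrite /bump leqNgt ltj.
by rewrite -leqNgt => leM; congr (v 'X^_ _ _); apply/eqP; rewrite eqn_leq leM -ltnS ltn_ord.
Qed.

(** Both sides expand into the same minors of [vdm v] with column [k] removed; the sign is the cost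
    of moving the replaced column from position [k] to position [M]. *)
Lemma bdet_cramer v (k : 'I_M.+1) P :
  bdet v (fun j => 'X^(bump k j)) P = (-1) ^+ (M + k) * (\adj (vdm v) *m v P) k ord0.
Proof.
rewrite mxE mulr_sumr bdetE; apply: eq_bigr => i _; rewrite mxE /cofactor.
set A := row' _ _; set B := row' _ _.
have -> : A = B by apply/matrixP=> r j; rewrite !mxE lift_max ltn_ord.
rewrite !exprD [in RHS]mulrA mulrCA !mulrA; move: (\det B) => dB.
by rewrite -!mulrA !(mulrCA _ ((-1) ^+ k)) signrMK; ring.
Qed.

Lemma bdet_bump_lt v k i : (k <= M)%N -> (i <= M)%N ->
  bdet v (fun j => 'X^(bump k j)) 'X^i = ((-1) ^+ (M + k) * hook v 0 0) *+ (i == k).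
Proof.
move=> lek lei; pose k' : 'I_M.+1 := Ordinal (lek : (k < M.+1)%N).
pose i' : 'I_M.+1 := Ordinal (lei : (i < M.+1)%N).
rewrite -[k]/(val k') bdet_cramer.
have -> : (\adj (vdm v) *m v 'X^i) k' ord0 = (\adj (vdm v) *m vdm v) k' i'.
  by rewrite !mxE; apply: eq_bigr => r _; congr (_ * _); rewrite mxE.
by rewrite mul_adj_mx mxE det_vdm mulrnAr -val_eqE eq_sym.
Qed.

Lemma bdet_bump_coef v k r P : (k <= M)%N -> (size P <= M.+1 + r)%N ->
  bdet v (fun j => 'X^(bump k j)) P =
    P`_k * ((-1) ^+ (M + k) * hook v 0 0)
    + \sum_(t < r) P`_(M.+1 + t) * bdet v (fun j => 'X^(bump k j)) 'X^(M.+1 + t).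
Proof.
move=> lek szP.
have {1}-> : P = \sum_(i < M.+1 + r) P`_i *: 'X^i.
  rewrite -poly_def; apply/polyP=> i; rewrite coef_poly.
  by case: ltnP => // /(leq_trans szP) /(nth_default 0).
rewrite linear_sum big_split_ord /=; congr (_ + _); last first.
  by apply: eq_bigr => i _; rewrite linearZ.
pose k' : 'I_M.+1 := Ordinal (lek : (k < M.+1)%N).
rewrite (bigD1 k') //= linearZ /= bdet_bump_lt // eqxx /= big1 ?addr0 // => i.
rewrite -val_eqE /= => /negPf nik; rewrite linearZ /= bdet_bump_lt ?nik ?mulr0 //.
by rewrite -ltnS.
Qed.

Lemma coef_kerp v e d : (d <= M)%N -> (0 < e)%N ->
  (kerp v e)`_(M - d) = - ((-1) ^+ d * hook v d e).
Proof.
move=> led e0; rewrite coefB coefZ coefXn coef_poly ltnS leq_subr subKn //.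
have /negPf -> : (M - d != M + e)%N by lia.
by rewrite mulr0 sub0r.
Qed.

Lemma coef_kerp_top v e : (0 < e)%N -> (kerp v e)`_(M + e) = hook v 0 0.
Proof.
move=> e0; rewrite coefB coefZ coefXn coef_poly eqxx mulr1.
have /negPf -> : ~~ (M + e < M.+1)%N by lia.
by rewrite subr0.
Qed.

Lemma coef_kerp_gt v e i : (M < i)%N -> i != (M + e)%N -> (kerp v e)`_i = 0.
Proof.
move=> ltMi /negPf ne; rewrite coefB coefZ coefXn coef_poly ne mulr0 ltnS leqNgt ltMi.
by rewrite subr0.
Qed.

Lemma size_kerp v e : (0 < e)%N -> (size (kerp v e) <= (M + e).+1)%N.
Proof. by move=> e0; apply/leq_sizeP => i lti; apply: coef_kerp_gt; lia. Qed.

Lemma kerpP v e : v (kerp v e) = 0.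
Proof.
have hE k : (k < M.+1)%N -> (-1) ^+ (M - k) * hook v (M - k) e
    = (\adj (vdm v) *m v 'X^(M + e)) (inord k) ord0.
  move=> ltk; rewrite /hook leq_subr subKn //.
  rewrite -[k in bump k]/(val (Ordinal ltk)) bdet_cramer.
  rewrite -signr_odd oddB // -oddD signr_odd signrMK.
  by have -> : Ordinal ltk = inord k by apply: val_inj; rewrite /= inordK.
rewrite linearB linearZ poly_def linear_sum /=.
apply/eqP; rewrite subr_eq0; apply/eqP.
(* With the coefficients read as [\adj (vdm v) *m v 'X^(M + e)], the product of [vdm v] with its
   adjugate is the scalar [hook v 0 0], which matches the top term. *)
have := mulmxA (vdm v) (\adj (vdm v)) (v 'X^(M+e)).
rewrite mul_mx_adj mul_scalar_mx det_vdm => <-.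
apply/matrixP=> i j; rewrite mxE summxE; apply: eq_bigr => k _.
by rewrite linearZ hE // [RHS]mxE inord_val (ord1 j) mulrC [vdm v i k]mxE.
Qed.

Lemma bdet_coef v r P : (size P <= M.+1 + r)%N ->
  bdet v (fun j => 'X^j) P = \sum_(t < r.+1) P`_(M + t) * hook v 0 t.
Proof.
move=> szP; rewrite (eq_bdet v v _ (fun j => 'X^(bump M j)) P P) //; last first.
  by move=> j ltj; rewrite /bump leqNgt ltj.
rewrite (bdet_bump_coef v M r) // big_ord_recl addn0 addnn -signr_odd odd_double mul1r.
by congr (_ + _); apply: eq_bigr => t _; rewrite /hook subn0 lift0 addSnnS.
Qed.

Lemma vdm_mul v m (E : 'I_m -> {poly R}) : (forall j, size (E j) <= M.+1)%N ->
  \matrix_(i < M.+1, j < m) v (E j) i ord0 =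
  vdm v *m \matrix_(k < M.+1, j < m) (E j)`_k.
Proof.
move=> szE; apply/matrixP=> i j; rewrite !mxE.
have {1}-> : E j = \sum_(k < M.+1) (E j)`_k *: 'X^k.
  rewrite -poly_def; apply/polyP=> k; rewrite coef_poly.
  by case: ltnP => // /(leq_trans (szE j)) /(nth_default 0).
rewrite linear_sum summxE; apply: eq_bigr => k _.
by rewrite linearZ !mxE mulrC.
Qed.

(** All columns have degree at most [M], so the determinant is that of [vdm v] times a determinant
    of coefficients, which is a sign. *)
Lemma bdet_affine1 v c :
  bdet v (fun j => ('X + c%:P) * 'X^j) 1 = (-1) ^+ M * hook v 0 0.
Proof.
rewrite /bdet (vdm_mul v _ (fun j => if (j < M)%N then ('X + c%:P) * 'X^j else 1)).
  rewrite det_mulmx det_vdm mulrC; congr (_ * _).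
  rewrite (expand_det_col _ ord_max) (bigD1 ord0) //= big1 ?addr0; last first.
    move=> i; rewrite -val_eqE /= => /negPf ni0.
    by rewrite !mxE ltnn coef1 ni0 mul0r.
  rewrite mxE ltnn coef1 eqxx mul1r /cofactor add0n -[RHS]mulr1; congr (_ * _).
  (* Without row 0, the coefficients of ['X^(j.+1) + c *: 'X^j] form an upper triangular matrix with
     unit diagonal; [det_trig] expects a lower triangular one. *)
  rewrite -det_tr det_trig; last first.
    apply/is_trig_mxP => i j ltij; rewrite !mxE lift_max ltn_ord.
    rewrite mulrDl -exprS coefD coefCM !coefXn lift0 eqSS.
    have /negPf -> : (j != i :> nat) by lia.
    by have /negPf -> : (j.+1 != i :> nat)%N; [lia | rewrite mulr0 addr0].
  apply: big1 => i _; rewrite !mxE lift_max ltn_ord.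
  rewrite mulrDl -exprS coefD coefCM !coefXn lift0 eqxx.
  by have /negPf -> : (i.+1 != i :> nat)%N; [lia | rewrite mulr0 addr0].
move=> j; case: ifP => [ltj|_]; last by rewrite size_poly1.
rewrite (leq_trans (size_polyMleq _ _)) // size_XaddC size_polyXn; lia.
Qed.

Lemma bdet_twist v Q E P :
  bdet v (fun j => Q * E j) (Q * P) = bdet (twist v Q) E P.
Proof. exact: eq_bdet. Qed.

Lemma bdet_twist_std v Q : bdet (twist v Q) (fun j => 'X^j) 'X^M = hook (twist v Q) 0 0.
Proof.
rewrite /hook subn0 addn0; apply: eq_bdet => // j ltj.
by rewrite /bump leqNgt ltj.
Qed.

Lemma bdet_affine v c P : (size P <= M.+2)%N ->
  bdet v (fun j => ('X + c%:P) * 'X^j) P =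
  P`_M.+1 * hook (twist v ('X + c%:P)) 0 0 + P.[- c] * ((-1) ^+ M * hook v 0 0).
Proof.
move=> szP; set T := bdet v _.
have T1 : T 1 = (-1) ^+ M * hook v 0 0 by exact: bdet_affine1.
have TS (i : nat) : T 'X^(i.+1) = T (('X + c%:P) * 'X^i) - c * T 'X^i.
  by rewrite mulrDl -exprS mul_polyC /T linearD linearZ /= addrK.
have Tle i : (i <= M)%N -> T 'X^i = (- c) ^+ i * T 1.
  elim: i => [|i IHi] lti; first by rewrite mul1r.
  rewrite TS IHi 1?ltnW // exprS {1}/T.
  by rewrite (bdet_repeat v (fun j => ('X + c%:P) * 'X^j)) //; ring.
have Ttop : T 'X^(M.+1) = hook (twist v ('X + c%:P)) 0 0 + (- c) ^+ M.+1 * T 1.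
  by rewrite TS Tle // /T bdet_twist bdet_twist_std exprS; ring.
have {1}-> : P = \sum_(i < M.+2) P`_i *: 'X^i.
  rewrite -poly_def; apply/polyP=> i; rewrite coef_poly.
  by case: ltnP => // /(leq_trans szP) /(nth_default 0).
have TZ a Q : T (a *: Q) = a * T Q by exact: linearZ.
rewrite (horner_coef_wide _ szP) [LHS]linear_sum /= -/T -T1 mulr_suml !big_ord_recr /=.
rewrite !TZ Ttop Tle // mulrDr !mulrA [RHS]addrC -!addrA [X in _ + (_ + X)]addrC.
congr (_ + _); apply: eq_bigr => i _.
by rewrite TZ Tle ?mulrA // ltnW.
Qed.

End BorderedDet.

(** * The shifted determinant as a value of the kernel polynomial *)

Lemma bordered0 (R : comNzRingType) (n : nat)
  (v : {linear {poly R} -> 'cV[R]_n}) (x : R) (P : {poly R}) :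
  bordered v x P ord0 ord0 = P.[x].
Proof.
have -> : ord0 = lshift n (ord0 : 'I_1) by exact: val_inj.
by rewrite /bordered col_mxEu mxE eqxx.
Qed.

Lemma bordered_lift (R : comNzRingType) (n : nat)
  (v : {linear {poly R} -> 'cV[R]_n}) (x : R) (P : {poly R}) (i : 'I_n) :
  bordered v x P (lift ord0 i) ord0 = v P i ord0.
Proof.
have -> : lift ord0 i = rshift 1 i by exact: val_inj.
by rewrite /bordered col_mxEd.
Qed.

(** Compute the bordered determinant with columns [('X + c%:P) * 'X^j] and [1] in two ways. Its top
    row vanishes except in the last column, which leaves the twisted hook; by [bdet_affine1] it is
    also, up to the same sign, the bordered [vdm], whose top row consists of the powers of [- c]. *)
Lemma hook_twist_expand (R : comNzRingType) (M : nat)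
  (v : {linear {poly R} -> 'cV[R]_M.+1}) (c : R) :
  hook (twist v ('X + c%:P)) 0 0 =
  c ^+ M.+1 * hook v 0 0 + \sum_(k < M.+1) c ^+ k * hook v (M - k) 1.
Proof.
have -> : hook (twist v ('X + c%:P)) 0 0 =
  \det (row' ord0 (col' ord_max
    (\matrix_(i < M.+2, j < M.+2)
       bordered v (- c) (if (j < M.+1)%N then ('X + c%:P) * 'X^j else 1) i ord0))).
  rewrite -det_vdm; congr (\det _); apply/matrixP=> i j.
  rewrite [LHS]mxE; do 3![rewrite [RHS]mxE].
  by rewrite lift_max ltn_ord bordered_lift.
have := bdet_affine1 (bordered v (- c)) c.
rewrite /bdet (expand_det_row _ ord0) (bigD1 ord_max) //= big1 ?addr0; last first.
  move=> j; rewrite -val_eqE /= => nej.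
  have ltj : (j < M.+1)%N by rewrite ltn_neqAle nej -ltnS ltn_ord.
  have root0 : (('X + c%:P) * 'X^j).[- c] = 0 by rewrite hornerM !hornerE addNr mul0r.
  by rewrite mxE ltj bordered0 root0 mul0r.
rewrite mxE ltnn bordered0 hornerC mul1r => eqD.
have {eqD} -> := can_inj (signrMK M.+1) eqD.
have term (k : 'I_M.+2) :
    vdm (bordered v (- c)) ord0 k * cofactor (vdm (bordered v (- c))) ord0 k =
    c ^+ k * \det (\matrix_(i < M.+1, j < M.+1) v 'X^(bump k j) i ord0).
  rewrite mxE bordered0 hornerXn /cofactor add0n mulrA -exprMn mulrN1 opprK.
  congr (_ * \det _); apply/matrixP=> i j; rewrite [RHS]mxE.
  by do 3![rewrite [LHS]mxE]; rewrite bordered_lift.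
rewrite -(det_vdm (bordered v (- c))) (expand_det_row _ ord0) big_ord_recr /= addrC.
congr (_ + _).
  rewrite term; congr (_ * _); rewrite -det_vdm; congr (\det _).
  apply/matrixP=> i j; rewrite !mxE; congr (v 'X^_ i ord0).
  by rewrite /bump leqNgt ltn_ord.
apply: eq_bigr => k _; rewrite term; congr (_ * _).
(* For [k <= M] the last remaining exponent is [bump k M = M.+1], hence a hook with [e = 1]. *)
rewrite /hook leq_subr subKn -1?ltnS // addn1; congr (\det _).
apply/matrixP=> i j; rewrite !mxE; case: ltnP => // leMj.
have -> : (j = M :> nat) by apply/eqP; rewrite eqn_leq leMj -ltnS ltn_ord.
by have -> : bump k M = M.+1 by rewrite /bump -ltnS ltn_ord add1n.
Qed.

(** The alternating signs of the coefficients combine with those of [(- c) ^+ k] into one common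
    sign, which leaves the sum of [hook_twist_expand]. *)
Lemma kerp_horner (R : comNzRingType) (M : nat)
  (v : {linear {poly R} -> 'cV[R]_M.+1}) (c : R) :
  (kerp v 1).[- c] = (-1) ^+ M.+1 * hook (twist v ('X + c%:P)) 0 0.
Proof.
rewrite hook_twist_expand hornerD hornerN hornerZ hornerXn (horner_coef_wide _ (size_poly _ _)).
rewrite mulrDr addn1; congr (_ + _); first by rewrite (exprNn c); ring.
rewrite mulr_sumr -sumrN; apply: eq_bigr => k _.
rewrite coef_poly ltn_ord (exprNn c).
have -> : (-1) ^+ M.+1 = - ((-1) ^+ (M - k) * (-1) ^+ k) :> R.
  by rewrite -exprD subnK -1?ltnS // exprS mulN1r.
ring.
Qed.

(** * The bilinear identities for an arbitrary linear functional *)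

Section Bilinear.
Context {R : comNzRingType} {M : nat} (v : {linear {poly R} -> 'cV[R]_M.+1}).
Implicit Types (w : {linear {poly R} -> 'cV[R]_M.+1}).

Lemma hook_eq0 (w : {poly R} -> 'cV[R]_M.+1) d e : (M < d)%N -> hook w d e = 0.
Proof. by move=> ltMd; rewrite /hook leqNgt ltMd. Qed.

Lemma coefX_kerp w e : (0 < e)%N -> ('X * kerp w e)`_M = hook w 1 e.
Proof.
(* When [M = 0], the constant term of a multiple of ['X] and the hook with [d > M] both vanish, so
   the convention for small [N] fits the formula. *)
move=> e0; rewrite coefXM; case: (posnP M) => [M0|Mgt0]; first by rewrite hook_eq0 ?M0.
by rewrite -subn1 coef_kerp //; ring.
Qed.

Lemma coefX2_kerp w e : (0 < e)%N -> ('X^2 * kerp w e)`_M = - hook w 2 e.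
Proof.
move=> e0; rewrite coefXnM; case: ltnP => ltM; first by rewrite hook_eq0 ?oppr0.
by rewrite coef_kerp //; ring.
Qed.

Lemma size_mul_kerp w e (P : {poly R}) d : (0 < e)%N -> (size P <= d.+1)%N ->
  (size (P * kerp w e)%R <= (M + e + d).+1)%N.
Proof.
move=> e0 szP; have := size_kerp w e e0; have := size_polyMleq P (kerp w e); lia.
Qed.

Lemma coef_affineS c (P : {poly R}) i : (('X + c%:P) * P)`_i.+1 = P`_i + c * P`_i.+1.
Proof. by rewrite mulrDl coefD coefXM coefCM. Qed.

Lemma coef_kerp0 w e : (0 < e)%N -> (kerp w e)`_M = - hook w 0 e.
Proof. by move=> e0; have := coef_kerp w e 0 (leq0n _) e0; rewrite subn0 mul1r. Qed.

Lemma coef_kerp1 w : (kerp w 1)`_M.+1 = hook w 0 0.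
Proof. by have := coef_kerp_top w 1 isT; rewrite addn1. Qed.

Lemma coef_kerp2 w : (kerp w 2)`_M.+2 = hook w 0 0.
Proof. by have := coef_kerp_top w 2 isT; rewrite addn2. Qed.

Lemma coef_affine_kerp w c e : (0 < e)%N ->
  (('X + c%:P) * kerp w e)`_M = hook w 1 e - c * hook w 0 e.
Proof. by move=> e0; rewrite mulrDl coefD coefX_kerp // coefCM coef_kerp0 ?mulrN. Qed.

Lemma kerp_twist Q e : v (Q * kerp (twist v Q) e) = 0.
Proof. exact: (kerpP (twist v Q)). Qed.

Lemma sign_consec n : (-1) ^+ n.+1 * (-1) ^+ n = -1 :> R.
Proof. by rewrite exprS mulN1r mulNr -expr2 sqrr_sign. Qed.

(** With columns [1, ..., 'X^(M-1)], the determinant of [('X + c%:P) * kerp w 1] vanishes. Its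
    coefficients at degrees [M], [M+1], [M+2], which involve hooks of [w], get paired with the hooks
    [(0, 0)], [(0, 1)], [(0, 2)] of [v]. *)
Lemma bilinear_fg c (w := twist v ('X + c%:P)) :
  hook w 0 0 * (c * hook v 0 1 + hook v 0 2)
  - hook w 0 1 * (c * hook v 0 0 + hook v 0 1) + hook v 0 0 * hook w 1 1 = 0.
Proof.
have szP : (size (('X + c%:P) * kerp w 1)%R <= M.+1 + 2)%N.
  by apply: leq_trans (size_mul_kerp w 1 _ 1 _ _) _; rewrite ?size_XaddC //; lia.
have := bdet_ker v (fun j => 'X^j) _ (kerp_twist ('X + c%:P) 1).
rewrite (bdet_coef v 2) // !big_ord_recl big_ord0 /= addn0.
rewrite addn1 addn2 !coef_affineS coef_affine_kerp // coef_kerp0 //.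
rewrite coef_kerp1 coef_kerp_gt; [|lia..].
by rewrite -/w => <-; ring.
Qed.

(** Same scheme with [kerp w 2], whose coefficient at degree [M.+1] is 0; one more degree enters,
    hence the hook [(0, 3)]. *)
Lemma bilinear_fh c (w := twist v ('X + c%:P)) :
  hook w 0 0 * (c * hook v 0 2 + hook v 0 3)
  - hook w 0 2 * (c * hook v 0 0 + hook v 0 1) + hook v 0 0 * hook w 1 2 = 0.
Proof.
have szP : (size (('X + c%:P) * kerp w 2)%R <= M.+1 + 3)%N.
  by apply: leq_trans (size_mul_kerp w 2 _ 1 _ _) _; rewrite ?size_XaddC //; lia.
have := bdet_ker v (fun j => 'X^j) _ (kerp_twist ('X + c%:P) 2).
rewrite (bdet_coef v 3) // !big_ord_recl big_ord0 /= addn0.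
rewrite addn1 addn2 addn3 !coef_affineS coef_affine_kerp // coef_kerp0 //.
rewrite coef_kerp2 !coef_kerp_gt; [|lia..].
by rewrite -/w => <-; ring.
Qed.

(** Omitting ['X^(M-1)] rather than ['X^M] from the columns selects the coefficients at degrees
    [M-1], [M+1], [M+2], paired with hooks of [v] with [d = 1]. *)
Lemma bilinear_fs c (w := twist v ('X + c%:P)) :
  hook w 0 0 * (c * hook v 1 1 + hook v 1 2)
  - hook v 0 0 * (c * hook w 1 1 - hook w 2 1) - hook w 0 1 * hook v 1 1 = 0.
Proof.
(* For [M = 0] the truncated [M - 1] would be [M] itself; here every term contains a hook with
   [d > M], which is 0. *)
have [M0|Mgt0] := posnP M; first by rewrite !(@hook_eq0 _ 1) ?(@hook_eq0 _ 2) ?M0 //; ring.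
have szP : (size (('X + c%:P) * kerp w 1)%R <= M.+1 + 2)%N.
  by apply: leq_trans (size_mul_kerp w 1 _ 1 _ _) _; rewrite ?size_XaddC //; lia.
have := bdet_ker v (fun j => 'X^(bump (M - 1) j)) _ (kerp_twist ('X + c%:P) 1).
rewrite (bdet_bump_coef v (M - 1) 2) ?leq_subr //.
rewrite !big_ord_recl big_ord0 /= addn0 addn1 !coef_affineS.
have -> : (('X + c%:P) * kerp w 1)`_(M - 1) = c * hook w 1 1 - hook w 2 1.
  have := coefX2_kerp w 1 isT.
  rewrite exprS expr1 -mulrA coefXM -[M in (M == _)]prednK // -subn1 /= => eX.
  by rewrite mulrDl coefD eX coefCM coef_kerp //; ring.
have -> : (-1) ^+ (M + (M - 1)) = -1 :> R.
  by rewrite -signr_odd oddD oddB // addbA addbb.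
have h1 : bdet v (fun j => 'X^(bump (M - 1) j)) 'X^(M.+1) = hook v 1 1.
  by rewrite /hook Mgt0 addn1.
have h2 : bdet v (fun j => 'X^(bump (M - 1) j)) 'X^(M.+2) = hook v 1 2.
  by rewrite /hook Mgt0 addn2.
rewrite h1 h2 coef_kerp0 //.
rewrite coef_kerp1 coef_kerp_gt; [|lia..].
by rewrite -/w => <-; ring.
Qed.

Lemma bilinear_shift p q (wp := twist v ('X + p%:P)) (wq := twist v ('X + q%:P))
    (wpq := twist wp ('X + q%:P)) :
  (p - q) * (hook wp 0 0 * hook wq 0 0 - hook v 0 0 * hook wpq 0 0)
  + hook wp 0 0 * hook wq 0 1 - hook wq 0 0 * hook wp 0 1 = 0.
Proof.
have := bdet_ker v (fun j => ('X + q%:P) * 'X^j) _ (kerp_twist ('X + p%:P) 1).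
(* The part divisible by ['X + q%:P] shares this factor with all columns and becomes a determinant
   for [wq]; the rest falls under [bdet_affine], where [kerp_horner] at [- q] yields the double
   shift. *)
rewrite -/wp; have -> : ('X + p%:P) * kerp wp 1 =
    ('X + q%:P) * kerp wp 1 + (p - q) *: kerp wp 1.
  by rewrite -mul_polyC polyCB; ring.
have sz : (size (kerp wp 1) <= M.+1 + 1)%N.
  by rewrite (leq_trans (size_kerp wp 1 _)) // addSn.
rewrite linearD linearZ /= bdet_twist -/wq (bdet_coef wq 1) //.
rewrite bdet_affine; last by rewrite -(addn1 M.+1).
rewrite kerp_horner -/wpq !big_ord_recl big_ord0 /= addn0 addn1 coef_kerp0 //.
rewrite coef_kerp1 -/wp -/wq.
rewrite mulrACA sign_consec => <-; ring.
Qed.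

(** The quartic is given by its quotient and remainder modulo [('X + p%:P) * ('X + q%:P)]. Against
    columns carrying this product, [lam] multiplies a vector that is 0, the [l] term loses one
    factor and is evaluated at [- q], and the quotient gives a determinant for [wpq]. *)
Lemma bilinear_quartic p q lam l m1 m0 (wp := twist v ('X + p%:P))
    (wq := twist v ('X + q%:P)) (wpq := twist wp ('X + q%:P)) :
  (forall P, v P = 0 ->
     v ((lam%:P + l *: ('X + p%:P)
         + ('X + p%:P) * ('X + q%:P) * ('X^2 + m1 *: 'X + m0%:P)) * P) = 0) ->
  - l * (hook v 0 0 * hook wpq 0 0 - hook wp 0 0 * hook wq 0 0)
  + m0 * (hook v 0 1 * hook wpq 0 0 - hook v 0 0 * hook wpq 0 1)
  + m1 * (hook v 0 1 * hook wpq 0 1 - hook v 0 0 * hook wpq 0 2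
          - hook wpq 0 0 * hook v 1 1)
  + hook v 0 1 * hook wpq 0 2 - hook v 1 1 * hook wpq 0 1
  - hook v 0 0 * hook wpq 0 3 + hook v 2 1 * hook wpq 0 0 = 0.
Proof.
move=> hL; pose E j := ('X + p%:P) * (('X + q%:P) * 'X^j) : {poly R}.
have v0 := kerpP v 1; have := bdet_ker v E _ (hL _ v0).
set L := _ * kerp v 1; have {L} -> : L = lam *: kerp v 1
    + (l *: (('X + p%:P) * kerp v 1) + ('X + p%:P) * (('X + q%:P) *
        ('X^2 * kerp v 1 + m1 *: ('X * kerp v 1) + m0 *: kerp v 1))).
  by rewrite /L -!mul_polyC; ring.
set Q := 'X^2 * _ + _ + _.
rewrite linearD linearZ /= (bdet_ker v E _ v0) mulr0 add0r linearD linearZ /=.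
have -> : bdet v E (('X + p%:P) * kerp v 1)
    = hook v 0 0 * hook wpq 0 0 - hook wq 0 0 * hook wp 0 0.
  rewrite bdet_twist bdet_affine; last by rewrite (leq_trans (size_kerp v 1 _)) // addn1.
  rewrite kerp_horner -/wp -/wpq -/wq coef_kerp1.
  rewrite mulrACA sign_consec mulN1r //.
have -> : bdet v E (('X + p%:P) * (('X + q%:P) * Q)) = bdet wpq (fun j => 'X^j) Q.
  exact: eq_bdet.
have szQ : (size Q <= M.+1 + 3)%N.
  have szC (b : R) (P : {poly R}) : (size P <= M.+1 + 3)%N -> (size (b *: P)%R <= M.+1 + 3)%N.
    exact: leq_trans (size_scale_leq _ _).
  rewrite (leq_trans (size_polyD _ _)) // geq_max.
  have s2 := size_mul_kerp v 1 'X^2 2 isT; have s1 := size_mul_kerp v 1 'X 1 isT.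
  have s0 := size_kerp v 1 isT; rewrite size_polyXn in s2; rewrite size_polyX in s1.
  rewrite szC ?andbT; last lia.
  rewrite (leq_trans (size_polyD _ _)) // geq_max szC ?andbT; first lia.
  by have := s1 isT; lia.
rewrite (bdet_coef wpq 3) // !big_ord_recl big_ord0 /= !addn0 addn1 addn2 addn3.
have X2S i : ('X^2 * kerp v 1)`_i.+1 = ('X * kerp v 1)`_i.
  by rewrite exprS expr1 -mulrA coefXM.
rewrite !coefD !coefZ !X2S coefX2_kerp // coefX_kerp // !coefXM /=.
rewrite coef_kerp0 // coef_kerp1 !coef_kerp_gt; [|lia..].
(* The vanishing determinant is the negative of the stated sum. *)
rewrite -/wpq /bump /= => e0; rewrite -[RHS]oppr0 -e0; ring.
Qed.

End Bilinear.

(** * Weighted point evaluations *)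

Lemma eq_hook (R : comNzRingType) (M : nat) (v w : {poly R} -> 'cV[R]_M.+1) d e :
  v =1 w -> hook v d e = hook w d e.
Proof. by move=> eqvw; rewrite /hook; case: ifP => // _; apply: eq_bdet. Qed.

Definition moments {R : comNzRingType} {n r : nat} (w x : 'I_n -> 'I_r -> R)
  (P : {poly R}) : 'cV[R]_n := \col_i \sum_(j < r) w i j * P.[x i j].

Lemma momentsE (R : comNzRingType) (n r : nat) (w x : 'I_n -> 'I_r -> R) P i :
  moments w x P i ord0 = \sum_(j < r) w i j * P.[x i j].
Proof. by rewrite mxE. Qed.

Lemma moments_is_linear (R : comNzRingType) (n r : nat) (w x : 'I_n -> 'I_r -> R) :
  linear (moments w x).
Proof.
move=> a P Q; apply/colP=> i; rewrite !mxE mulr_sumr -big_split.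
by apply: eq_bigr => j _ /=; rewrite hornerD hornerZ; ring.
Qed.
HB.instance Definition _ (R : comNzRingType) (n r : nat) (w x : 'I_n -> 'I_r -> R) :=
  GRing.isLinear.Build R {poly R} 'cV[R]_n _ (moments w x)
    (moments_is_linear R n r w x).

Lemma moments_twist (R : comNzRingType) (n r : nat) (w w' x : 'I_n -> 'I_r -> R) Q :
  (forall i j, w' i j = w i j * Q.[x i j]) -> moments w' x =1 twist (moments w x) Q.
Proof.
move=> ww' P; apply/colP=> i; rewrite [LHS]momentsE [RHS](@momentsE _ _ _ w x (Q * P)).
apply: eq_bigr => j _.
by rewrite ww' hornerM mulrA.
Qed.

(** Multiplication by [L] scales row [i] by [c i]; the factor may vary from row to row, as a zero
    vector stays zero. *)
Lemma moments_ker_mul (R : comNzRingType) (n r : nat) (w x : 'I_n -> 'I_r -> R)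
    (L P : {poly R}) (c : 'I_n -> R) :
  (forall i j, L.[x i j] = c i) -> moments w x P = 0 -> moments w x (L * P) = 0.
Proof.
move=> Lc vP; apply/colP=> i; rewrite momentsE mxE.
transitivity (c i * moments w x P i ord0); last by rewrite vP mxE mulr0.
rewrite momentsE mulr_sumr; apply: eq_bigr => j _.
by rewrite hornerM Lc; ring.
Qed.

(** * Casoratians as hooks of moment functionals *)

Section Casoratian.
Context {C : numClosedFieldType} {M : nat} (om rho : 'I_M.+1 -> 'I_4 -> C).
Context (p q a b : C) (al be : int).

(** The factor [(- om s j) ^+ l] of [psi] is left out: it is the value of ['X^l] at the node. *)
Definition weight (n m : int) (s : 'I_M.+1) (j : 'I_4) : C :=
  rho s j * (p - om s j) ^ n * (q - om s j) ^ m * (a - om s j) ^ al * (b - om s j) ^ be.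

Definition node (s : 'I_M.+1) (j : 'I_4) : C := - om s j.

(** The size condition is an equality of booleans so that the case [M < d], where both sides are 0
    by convention, is covered as well. *)
Lemma casor_hook L d e n m :
  (size L == M.+1) = (d <= M)%N ->
  ((d <= M)%N -> forall j, (j < M.+1)%N ->
     nth 0%N L j = if (j < M)%N then bump (M - d) j else (M + e)%N) ->
  casor om rho p q a b L n m al be = hook (moments (weight n m) node) d e.
Proof.
move=> szL nthL; rewrite /casor /hook szL; case: ifP => // led.
congr (\det _); apply/matrixP=> i j; rewrite !mxE (nthL led) // /psi.
by case: ifP => _; apply: eq_bigr => k _; rewrite hornerXn /weight; ring.
Qed.

Lemma casor_idx0 l n m :
  casor om rho p q a b (iota 0 (M.+1 - 1) ++ [:: (M + l)%N]) n m al be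
  = hook (moments (weight n m) node) 0 l.
Proof.
apply: casor_hook; rewrite subSS subn0; first by rewrite size_cat size_iota addn1 eqxx.
move=> _ j ltj; rewrite nth_cat size_iota; case: ltnP => [ltjM|leMj].
  by rewrite nth_iota // add0n /bump leqNgt ltjM.
by have -> : (j - M = 0)%N by lia.
Qed.

Lemma casor_idx1 l n m :
  casor om rho p q a b (iota 0 (M.+1 - 2) ++ [:: (M.+1 - 1)%N; (M + l)%N]) n m al be
  = hook (moments (weight n m) node) 1 l.
Proof.
apply: casor_hook; first by rewrite size_cat size_iota /=; lia.
move=> M1 j ltj; rewrite nth_cat size_iota; case: ltnP => [lt1|le1].
  by rewrite nth_iota // /bump; case: ifP; lia.
have [jM|ltjM] := leqP M j; first by have -> : (j - (M.+1 - 2) = 1)%N by lia.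
by have -> : (j - (M.+1 - 2) = 0)%N; [lia | rewrite /= /bump; lia].
Qed.

Lemma casor_nu n m :
  casor om rho p q a b (nu_idx M.+1) n m al be
  = hook (moments (weight n m) node) 2 1.
Proof.
apply: casor_hook; first by rewrite size_cat size_iota /=; lia.
move=> M2 j ltj; rewrite /nu_idx nth_cat size_iota; case: ltnP => [lt1|le1].
  by rewrite nth_iota // /bump; case: ifP; lia.
have [jM|ltjM] := leqP M j.
  by have -> : (j - (M.+1 - 3) = 2)%N; [lia | rewrite /=; lia].
have [jM1|ltjM1] := leqP (M - 1) j.
  by have -> : (j - (M.+1 - 3) = 1)%N; [lia | rewrite /= /bump; lia].
by have -> : (j - (M.+1 - 3) = 0)%N; [lia | rewrite /= /bump; lia].
Qed.

Hypothesis om_p : forall s j, p - om s j != 0.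
Hypothesis om_q : forall s j, q - om s j != 0.

(** The value of ['X + p%:P] at the node is [p - om s j]; since it is nonzero, it splits off from an
    integer power of any sign. *)
Lemma moments_tilde n m :
  moments (weight (n + 1) m) node =1 twist (moments (weight n m) node) ('X + p%:P).
Proof.
apply: moments_twist => s j; rewrite /weight /node expfzDr // expr1z hornerD hornerX hornerC; ring.
Qed.

Lemma moments_hat n m :
  moments (weight n (m + 1)) node =1 twist (moments (weight n m) node) ('X + q%:P).
Proof.
apply: moments_twist => s j; rewrite /weight /node expfzDr // expr1z hornerD hornerX hornerC; ring.
Qed.

Lemma moments_hattilde n m :
  moments (weight (n + 1) (m + 1)) node =1
  twist (twist (moments (weight n m) node) ('X + p%:P)) ('X + q%:P).
Proof. by move=> P; rewrite moments_hat; exact: moments_tilde. Qed.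

End Casoratian.

Theorem theorem3p1 (C : numClosedFieldType) (a1 a2 a3 p q a b : C) (N : nat)
  (k : 'I_N -> C) (om rho : 'I_N -> 'I_4 -> C) :
  uniq [:: p; q; a; b] -> (0 < N)%N ->
  (forall s : 'I_N,
     \prod_(j < 4) ('X - (om s j)%:P) =
       'X^4 - a3 *: 'X^3 + a2 *: 'X^2 - a1 *: 'X
       - (k s ^+ 4 - a3 * k s ^+ 3 + a2 * k s ^+ 2 - a1 * k s)%:P) ->
  (forall s : 'I_N, om s ord_max = k s) ->
  (forall (s : 'I_N) (j : 'I_4), om s j \notin [:: p; q; a; b]) ->
  forall al be : int,
  let F := fun L n m => casor om rho p q a b L n m al be in
  let f := F (f_idx N) in
  let g := F (g_idx N) in
  let h := F (h_idx N) in
  let s := F (s_idx N) in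
  let mu := F (mu_idx N) in
  let th := F (theta_idx N) in
  let nu := F (nu_idx N) in
  forall n m : int,
  (f (n + 1) m * (p * g n m + h n m) - g (n + 1) m * (p * f n m + g n m)
        + f n m * s (n + 1) m = 0) /\ (
      f n (m + 1) * (q * g n m + h n m) - g n (m + 1) * (q * f n m + g n m)
        + f n m * s n (m + 1) = 0) /\ (
      f (n + 1) m * (p * h n m + mu n m) - h (n + 1) m * (p * f n m + g n m)
        + f n m * th (n + 1) m = 0) /\ (
      f n (m + 1) * (q * h n m + mu n m) - h n (m + 1) * (q * f n m + g n m)
        + f n m * th n (m + 1) = 0) /\ (
      f (n + 1) m * (p * s n m + th n m) - f n m * (p * s (n + 1) m - nu (n + 1) m)
        - g (n + 1) m * s n m = 0) /\ (
      f n (m + 1) * (q * s n m + th n m) - f n m * (q * s n (m + 1) - nu n (m + 1))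
        - g n (m + 1) * s n m = 0) /\ (
      (p - q) * (f (n + 1) m * f n (m + 1) - f n m * f (n + 1) (m + 1))
        + f (n + 1) m * g n (m + 1) - f n (m + 1) * g (n + 1) m = 0) /\ (
      Gfun a1 a2 a3 (- p) (- q) / (p - q)
          * (f n m * f (n + 1) (m + 1) - f (n + 1) m * f n (m + 1))
        + Hfun a2 a3 p q * (g n m * f (n + 1) (m + 1) - f n m * g (n + 1) (m + 1))
        - (p + q - a3) * (g n m * g (n + 1) (m + 1) - f n m * h (n + 1) (m + 1)
                          - f (n + 1) (m + 1) * s n m)
        + g n m * h (n + 1) (m + 1) - s n m * g (n + 1) (m + 1)
        - f n m * mu (n + 1) (m + 1) + nu n m * f (n + 1) (m + 1) = 0).
Proof.
case: N k om rho => [//|M] k om rho pq_uniq _ omP _ om_pq al be F f g h s mu th nu n m.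
have om_p i j : p - om i j != 0.
  by have := om_pq i j; rewrite subr_eq0 eq_sym !inE !negb_or => /and4P[].
have om_q i j : q - om i j != 0.
  by have := om_pq i j; rewrite subr_eq0 eq_sym !inE !negb_or => /and4P[].
have pq : p - q != 0.
  by move: pq_uniq; rewrite subr_eq0 /= !inE !negb_or => /andP[/and3P[]].
pose v n' m' := moments (weight om rho p q a b al be n' m') (node om).
have fE n' m' : f n' m' = hook (v n' m') 0 0.
  rewrite -casor_idx0 /f /F /f_idx addn0; congr casor.
  by rewrite -[in LHS]addn1 iotaD subSS subn0.
have gE n' m' : g n' m' = hook (v n' m') 0 1 by rewrite -casor_idx0 addn1.
have hE n' m' : h n' m' = hook (v n' m') 0 2 by rewrite -casor_idx0 addn2.
have muE n' m' : mu n' m' = hook (v n' m') 0 3 by rewrite -casor_idx0 addn3.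
have sE n' m' : s n' m' = hook (v n' m') 1 1 by rewrite -casor_idx1 addn1.
have thE n' m' : th n' m' = hook (v n' m') 1 2 by rewrite -casor_idx1 addn2.
have nuE n' m' : nu n' m' = hook (v n' m') 2 1 by rewrite -casor_nu.
have tE d e : hook (v (n + 1) m) d e = hook (twist (v n m) ('X + p%:P)) d e.
  exact/eq_hook/moments_tilde.
have hatE d e : hook (v n (m + 1)) d e = hook (twist (v n m) ('X + q%:P)) d e.
  exact/eq_hook/moments_hat.
have htE d e : hook (v (n + 1) (m + 1)) d e =
    hook (twist (twist (v n m) ('X + p%:P)) ('X + q%:P)) d e.
  exact/eq_hook/moments_hattilde.
rewrite !(fE, gE, hE, muE, sE, thE, nuE) !(tE, hatE, htE).
do 2![split; first exact: bilinear_fg]; do 2![split; first exact: bilinear_fh].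
do 2![split; first exact: bilinear_fs]; split; first exact: bilinear_shift.
(* Division of [L] by [('X + p%:P) * ('X + q%:P)] has remainder [L(-p) + l (X + p)], where [l] is
   the divided difference of [L] between [-p] and [-q]; as [Gfun] at [(-p, -q)] is [L(-p) - L(-q)],
   the quotient by [p - q] is [- l]. The quotient of [L] is [X^2 + (a3 - (p + q)) X + H(p, q)]. *)
pose l : C := a1 - a2 * (p + q) + a3 * (p ^+ 2 + p * q + q ^+ 2)
  - (p ^+ 3 + p ^+ 2 * q + p * q ^+ 2 + q ^+ 3).
have -> : Gfun a1 a2 a3 (- p) (- q) / (p - q) = - l.
  by apply: (canLR (mulfK pq)); rewrite /Gfun /l; ring.
have quartic := @bilinear_quartic _ _ (v n m) p q
  (p ^+ 4 - a3 * p ^+ 3 + a2 * p ^+ 2 - a1 * p) l (a3 - (p + q)) (Hfun a2 a3 p q).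
apply: etrans (quartic _); first by ring.
move=> P.
(* The common value of [L] at the four nodes [- om i j], read off by evaluating the factorization
   [omP] at its root [om i j]. *)
pose c i := k i ^+ 4 - a3 * k i ^+ 3 + a2 * k i ^+ 2 - a1 * k i.
rewrite /v.
apply: (moments_ker_mul _ _ _ _ _ _ _ c) => i j.
have := congr1 (fun Q => Q.[om i j]) (omP i).
rewrite horner_prod (bigD1 j) //= hornerXsubC subrr mul0r.
rewrite !(hornerD, hornerN, hornerZ, hornerXn, hornerX, hornerC) -/(c i) => /esym/subr0_eq <-.
by rewrite !(hornerM, hornerD, hornerZ, hornerXn, hornerX, hornerC) /node /l /Hfun; ring.
Qed.
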